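(* If $\boldsymbol\varepsilon$ is a spherically symmetric $m$-dimensional random vector with an arbitrary finite mean (i.e. $\boldsymbol\varepsilon-\mathrm E\,\boldsymbol\varepsilon$ is spherically symmetric around $\mathbf 0$), then $\boldsymbol\varepsilon$ is axially symmetric around axes in direction $\mathbf v$ for all unit vectors $\mathbf v\in\mathbb R^m$.
   Context: $m\ge2$ is an integer and $\mathcal L(\boldsymbol Z)$ denotes the distribution of $\boldsymbol Z$. A random vector $\boldsymbol Z$ is spherically symmetric around $\mathbf 0$ if $\mathcal L(\boldsymbol Z)=\mathcal L(\mathbf A\boldsymbol Z)$ for every orthogonal matrix $\mathbf A$. A random vector $\boldsymbol Z$ with finite expectation is axially symmetric around an axis in direction $\mathbf v$, $\|\mathbf v\|=1$, if $\mathcal L(\boldsymbol Z-\mathrm E\boldsymbol Z)=\mathcal L(\mathbf R_{\mathbf v}(\boldsymbol Z-\mathrm E\boldsymbol Z))$, where $\mathbf R_{\mathbf v}=2\mathbf v\mathbf v^\top-\mathbf I$. *)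

(* Defs.v *)
From HB Require Import structures.
From mathcomp Require Import all_boot all_order all_algebra.
From mathcomp Require Import all_classical all_reals all_analysis.

Set Implicit Arguments.
Unset Strict Implicit.
Unset Printing Implicit Defensive.

Import Order.TTheory GRing.Theory Num.Theory.
Import numFieldNormedType.Exports.

Local Open Scope classical_set_scope.
Local Open Scope ring_scope.

(* R^m, as column vectors, with its Borel sigma-algebra: the library topology
   on matrices is the product topology, so [open] is the usual one. *)
Notation borel_cV R m := (g_sigma_algebraType (@open 'cV[R]_m)).

Lemma continuous_mx (R : realType) (T : topologicalType) (m n : nat)
    (f : T -> 'M[R]_(m, n)) :
  (forall i j, continuous (fun x => f x i j)) -> continuous f.
Proof.
move=> cf x B [/= V nV sVB].
have H : \forall y \near x, forall i j, V i j (f y i j).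
  apply: (@filter_forall _ _ (fun i y => forall j, V i j (f y i j))) => i.
  apply: (@filter_forall _ _ (fun j y => V i j (f y i j))) => j.
  exact: (cf i j x _ (nV i j)).
by apply: filterS H => y Hy; exact: sVB.
Qed.

Lemma continuous_borel_measurable (R : realType) (m n : nat)
    (f : 'cV[R]_m -> 'cV[R]_n) :
  continuous f -> measurable_fun setT (f : borel_cV R m -> borel_cV R n).
Proof.
move=> cf.
apply: (@measurability _ _ (borel_cV R m) (borel_cV R n) setT f open) => //.
move=> _ [B oB <-]; rewrite setTI.
by apply: sub_sigma_algebra; move/continuousP: cf; apply.
Qed.

Section linear_algebra.
Context (R : realType) (m : nat).

Definition orthogonal_mx (A : 'M[R]_m) : Prop := A^T *m A = 1%:M.

(* The norm `|v| that the library puts on matrices is the sup norm. *)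
Definition euclid_norm (v : 'cV[R]_m) : R := Num.sqrt (\sum_i v i ord0 ^+ 2).

Definition axial_mx (v : 'cV[R]_m) : 'M[R]_m := 2 *: (v *m v^T) - 1%:M.

End linear_algebra.

Section random_vectors.
Context d (T : measurableType d) (R : realType) (P : probability T R).

(* [distribution P X] is a function on all sets, so equality of laws is tested
   on measurable sets only. *)
Definition eq_law d' (S : measurableType d') (X Y : {RV P >-> S}) : Prop :=
  forall B : set S, measurable B -> distribution P X B = distribution P Y B.

Context (m : nat).

Definition finite_mean (Z : {RV P >-> borel_cV R m}) : Prop :=
  forall i, P.-integrable [set: T] (fun w => (Z w i ord0)%:E).

(* Meaningful only under [finite_mean]. *)
Definition mean_vec (Z : {RV P >-> borel_cV R m}) : 'cV[R]_m :=
  \col_i fine 'E_P[fun w => Z w i ord0]%E.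

Definition centered (Z : {RV P >-> borel_cV R m}) : T -> borel_cV R m :=
  fun w => (Z w : 'cV[R]_m) - mean_vec Z.

Lemma measurable_centered Z : measurable_fun setT (centered Z).
Proof.
apply: (measurableT_comp (f := (fun z : 'cV[R]_m => z - mean_vec Z)
  : borel_cV R m -> borel_cV R m)) => //.
apply: continuous_borel_measurable; apply: continuous_mx => i j.
rewrite [X in continuous X](_ : _ =
  fun z : 'cV[R]_m => z i j - mean_vec Z i j); last first.
  by apply/funext => z; rewrite !mxE.
move=> z; apply: continuousB; last exact: cst_continuous.
exact: (@coord_continuous R m 1 i j z).
Qed.

HB.instance Definition _ Z := isMeasurableFun.Build _ _ _ _ (centered Z)
  (measurable_centered Z).

Definition lin_image (A : 'M[R]_m) (Z : {RV P >-> borel_cV R m}) :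
    T -> borel_cV R m :=
  fun w => A *m (Z w : 'cV[R]_m).

Lemma measurable_lin_image A Z : measurable_fun setT (lin_image A Z).
Proof.
apply: (measurableT_comp (f := (fun z : 'cV[R]_m => A *m z)
  : borel_cV R m -> borel_cV R m)) => //.
apply: continuous_borel_measurable; apply: continuous_mx => i j.
rewrite [X in continuous X](_ : _ =
  fun z : 'cV[R]_m => \sum_k A i k * z k j); last first.
  by apply/funext => z; rewrite mxE.
apply: continuous_big => [|k _ z]; first exact: add_continuous.
apply: continuousM; first exact: cst_continuous.
exact: (@coord_continuous R m 1 k j z).
Qed.

HB.instance Definition _ A Z := isMeasurableFun.Build _ _ _ _ (lin_image A Z)
  (measurable_lin_image A Z).

(* Around the origin. *)
Definition spherically_symmetric (Z : {RV P >-> borel_cV R m}) : Prop :=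
  forall A : 'M[R]_m, orthogonal_mx A -> eq_law Z (lin_image A Z).

Definition axially_symmetric (Z : {RV P >-> borel_cV R m}) (v : 'cV[R]_m) :
    Prop :=
  [/\ finite_mean Z, euclid_norm v = 1
    & eq_law (centered Z) (lin_image (axial_mx v) (centered Z))].

End random_vectors.

Arguments eq_law {d T R} P {d' S} X Y.
Arguments finite_mean {d T R} P {m} Z.
Arguments mean_vec {d T R} P {m} Z.
Arguments centered {d T R} P {m} Z _.
Arguments lin_image {d T R} P {m} A Z _.
Arguments spherically_symmetric {d T R} P {m} Z.
Arguments axially_symmetric {d T R} P {m} Z v.

(* Main.v *)
Require Import Defs.
From mathcomp Require Import all_boot all_order all_algebra.
From mathcomp Require Import all_classical all_reals all_analysis.

Import Order.TTheory GRing.Theory Num.Theory.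
Import numFieldNormedType.Exports.

Local Open Scope classical_set_scope.
Local Open Scope ring_scope.

(** For a unit [v], [v *m v^T] projects orthogonally onto the axis, so [axial_mx v] fixes the axis
    and negates its orthogonal complement. It is therefore orthogonal ([axial_mx_orthogonal]), and
    axial symmetry is one instance of the spherical symmetry of the centered vector. *)

Lemma trmx_mul_unit (R : realType) (m : nat) (v : 'cV[R]_m) :
  euclid_norm v = 1 -> v^T *m v = 1%:M.
Proof.
move=> v1; apply/matrixP => i j; rewrite !ord1 !mxE eqxx /=.
(* Writing 1 as the square of [euclid_norm v] removes the square root. *)
rewrite -[RHS](expr1n R 2) -v1 sqr_sqrtr; last first.
  by apply: sumr_ge0 => k _; exact: sqr_ge0.
by apply: eq_bigr => k _; rewrite mxE expr2.
Qed.

(* [v v^T] is a symmetric idempotent, so [2 v v^T - 1] is a symmetric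
   involution. *)
Lemma axial_mx_orthogonal (R : realType) (m : nat) (v : 'cV[R]_m) :
  euclid_norm v = 1 -> orthogonal_mx (axial_mx v).
Proof.
move=> /trmx_mul_unit vv; rewrite /orthogonal_mx /axial_mx.
have idem : (v *m v^T) *m (v *m v^T) = v *m v^T.
  by rewrite mulmxA -(mulmxA v) vv mulmx1.
have sym : (2 *: (v *m v^T) - 1%:M)^T = 2 *: (v *m v^T) - 1%:M.
  by rewrite linearB linearZ /= trmx_mul trmxK tr_scalar_mx.
rewrite sym mulmxBl mulmxBr mul1mx mulmx1 -scalemxAl -scalemxAr idem.
(* With M = [v *m v^T], what remains is 4M - 2M - (2M - 1) = 1. *)
by rewrite !scaler_nat mulr2n addrK opprB addrC subrK.
Qed.

Theorem lemma4 (R : realType) (d : measure_display) (T : measurableType d)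
    (P : probability T R) (m : nat) (hm : (2 <= m)%N)
    (eps : {RV P >-> borel_cV R m}) (hmean : finite_mean P eps)
    (hsph : spherically_symmetric P (centered P eps)) :
  forall v : 'cV[R]_m, euclid_norm v = 1 -> axially_symmetric P eps v.
Proof.
move=> v v1; split=> //.
exact: hsph _ (axial_mx_orthogonal _ _ _ v1).
Qed.
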